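(* Let $T$ be a tree rooted at $o$ and let $X$ be either $\mathcal{L}_{\mathbf{w}}$ or $\mathcal{L}_{\mathbf{w},0}$. The only isometric multiplication operators on $X$ are those induced by the constant functions of modulus one; that is, for $\psi:T\to\mathbb{C}$, $M_\psi$ maps $X$ into $X$ and satisfies $\|\psi f\|_{\mathbf{w}}=\|f\|_{\mathbf{w}}$ for all $f\in X$ if and only if $\psi$ is a constant function of modulus one.
   Context: A tree $T$ is a locally finite, connected, simply-connected graph, identified with its set of vertices; $T$ is assumed to have no terminal vertices (vertices with exactly one neighbor), so it is infinite, and it is rooted at a vertex $o$. $|v|$ is the number of edges in the unique path from $o$ to $v$; $T^*=T\setminus\{o\}$; for $v\in T^*$, $v^-$ is the neighbor of $v$ closest to $o$. For $f:T\to\mathbb{C}$ and $v\in T^*$, $Df(v)=|f(v)-f(v^-)|$. The weighted Lipschitz space $\mathcal{L}_{\mathbf{w}}$ is the set of $f:T\to\mathbb{C}$ with $\sup_{v\in T^*}|v|Df(v)<\infty$, normed by $\|f\|_{\mathbf{w}}=|f(o)|+\sup_{v\in T^*}|v|Df(v)$ (a Banach space). The little weighted Lipschitz space $\mathcal{L}_{\mathbf{w},0}$ is the closed subspace of those $f\in\mathcal{L}_{\mathbf{w}}$ with $\lim_{|v|\to\infty}|v|Df(v)=0$. The multiplication operator with symbol $\psi$ is $M_\psi f=\psi f$ (pointwise product). *)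

(* Defs.v *)
From HB Require Import structures.
From mathcomp Require Import all_boot all_order all_algebra.
From mathcomp Require Import complex.
From mathcomp Require Import all_classical all_reals all_analysis.

Set Implicit Arguments.
Unset Strict Implicit.
Unset Printing Implicit Defensive.

Import Order.TTheory GRing.Theory Num.Theory.
Import numFieldNormedType.Exports.

Local Open Scope classical_set_scope.
Local Open Scope ring_scope.

(* An edge {u, v} is represented by the two boolean facts adj u v and
   adj v u.  In tree_acyclic, [:: u; v] is a ucycle for every edge {u, v},
   which is why only cycles with at least three vertices are excluded.
   tree_infinite rules out the one-vertex graph, for which
   tree_no_terminal holds vacuously. *)
Record tree := Tree {
  vertex :> choiceType;
  adj : rel vertex;
  adj_sym : symmetric adj;
  adj_irr : irreflexive adj;
  tree_locally_finite : forall v : vertex, finite_set [set w | adj v w];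
  tree_connected : forall u v : vertex,
    exists p : seq vertex, path adj u p /\ last u p = v;
  tree_acyclic : forall c : seq vertex, ucycle adj c -> (size c <= 2)%N;
  tree_no_terminal : forall v : vertex, ~ exists! w : vertex, adj v w;
  tree_infinite : infinite_set [set: vertex] }.

Section RootedTree.
Variables (T : tree) (o : T).

(* The path from o to v without repeated vertices, given as in path.v by the
   list of its vertices other than o; the default [::] is never reached. *)
Definition root_path (v : T) : seq T :=
  xget [::] [set p : seq T |
    [/\ path (@adj T) o p, uniq (o :: p) & last o p = v]].

Definition level (v : T) : nat := size (root_path v).

(* v^- for v <> o; the value at v = o is irrelevant. *)
Definition parent (v : T) : T :=
  xget v [set u : T | adj v u /\
    forall w : T, adj v w -> (level u <= level w)%N].

(* The filter of |v| --> +oo. *)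
Definition level_infty : set_system T :=
  filter_from [set: nat] (fun n => [set v : T | (n <= level v)%N]).

Global Instance level_infty_filter : Filter level_infty.
Proof.
apply: filter_from_filter; first by exists 0%N.
move=> m n _ _; exists (maxn m n) => // v /=.
by rewrite geq_max => /andP[].
Qed.

Variable R : realType.
Implicit Types (f psi : T -> R[i]) (X : set (T -> R[i])).

(* Normc.normc is the modulus with values in R, whereas `|z| is in R[i]. *)
Definition grad f (v : T) : R := Normc.normc (f v - f (parent v)).

Definition weighted_grads f : set R :=
  [set (level v)%:R * grad f v | v in [set v : T | v <> o]].

(* sup is the real-valued supremum, meaningful because Lw requires the set
   to be bounded above. *)
Definition Lw : set (T -> R[i]) := [set f | has_ubound (weighted_grads f)].

Definition normw f : R := Normc.normc (f o) + sup (weighted_grads f).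

Definition Lw0 : set (T -> R[i]) :=
  [set f | Lw f /\ (level v)%:R * grad f v @[v --> level_infty] --> (0 : R)].

Definition mult_op psi f : T -> R[i] := fun v => psi v * f v.

Definition isometric_mult_op X psi : Prop :=
  (forall f, X f -> X (mult_op psi f)) /\
  (forall f, X f -> normw (mult_op psi f) = normw f).

End RootedTree.

(* Main.v *)
(* Testing the isometry on the indicator of o, whose norm is 2, gives
   2|psi(o)| = 2.  Testing on the constant 1 then gives
   |psi(o)| + sup |v| Dpsi(v) = 1, so Dpsi vanishes off o and psi is constant.
   Both test functions lie in the little space. *)
Require Import Defs.
From mathcomp Require Import all_boot all_order all_algebra.
From mathcomp Require Import complex.
From mathcomp Require Import all_classical all_reals all_analysis.

Import Order.TTheory GRing.Theory Num.Theory.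
Import numFieldNormedType.Exports.

Local Open Scope classical_set_scope.
Local Open Scope ring_scope.

(** * Simple paths, levels and parents in a rooted tree *)

Section Paths.
Set Implicit Arguments.
Unset Strict Implicit.
Variable T : tree.
Implicit Types (o u v w x : T) (p q : seq T).

(* At the first vertex x where two paths diverge, towards a and b, their
   remainders join a to b away from x, which closes a cycle through x. *)
Lemma simple_path_unique x p q :
  path (@adj T) x p -> uniq (x :: p) -> path (@adj T) x q -> uniq (x :: q) ->
  last x p = last x q -> p = q.
Proof.
elim: p x q => [|a p IH] x [|b q] //=.
- by move=> _ _ _ /andP[xNq _] xE; rewrite xE mem_last in xNq.
- by move=> _ /andP[xNp _] _ _ xE; rewrite -xE mem_last in xNp.
move=> /andP[xa pa] /andP[xNp up] /andP[xb qb] /andP[xNq uq] lE.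
have [ab|ab] := eqVneq a b.
  by rewrite -ab in qb uq lE *; rewrite (IH a q).
exfalso.
pose r := p ++ rev (belast b q).
have pr : path (@adj T) a r.
  rewrite cat_path pa lE rev_path (eq_path (e' := @adj T)) //.
  by move=> y z; exact: adj_sym.
have lr : last a r = b.
  rewrite last_cat lE; case: (q) => //= c s.
  by rewrite rev_cons last_rcons.
have xNr : x \notin a :: r.
  rewrite inE mem_cat mem_rev !negb_or.
  move: xNp; rewrite inE negb_or => /andP[-> ->] /=.
  by apply: contra xNq => /mem_belast.
(* The walk [r] may repeat vertices; shortening keeps its ends and uses only vertices of [r], so [x]
   is still avoided. *)
case: (shortenP pr) lr => s ps us srs bs.
have := @tree_acyclic T (x :: a :: s); rewrite /ucycle /= rcons_path xa ps bs.
rewrite adj_sym xb /=.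
have -> : x \notin a :: s.
  apply: contra xNr; rewrite !inE => /orP[->//|/srs ->]; exact: orbT.
have -> /= : (a \notin s) && uniq s by [].
(* The cycle has at least three vertices unless [s] is empty, and then [a = b]. *)
case: s bs {ps us srs} => [/= aE|c s _ /(_ isT)//].
by rewrite aE eqxx in ab.
Qed.

Lemma root_pathP o v :
  [/\ path (@adj T) o (root_path o v), uniq (o :: root_path o v)
    & last o (root_path o v) = v].
Proof.
rewrite /root_path; case: xgetP => // nP.
have [p [pp lp]] := @tree_connected T o v; exfalso.
by case: (shortenP pp) lp => s ps us _ ls; apply: (nP s).
Qed.

Lemma root_path_eq o v p :
  path (@adj T) o p -> uniq (o :: p) -> last o p = v -> root_path o v = p.
Proof.
move=> pp up lp; have [rp ur lr] := root_pathP o v.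
by apply: simple_path_unique (pp) up _ => //; rewrite lp.
Qed.

Lemma level_root o : level o o = 0%N.
Proof. by rewrite /level (@root_path_eq o o [::]). Qed.

Lemma level_eq0 o v : level o v = 0%N -> v = o.
Proof. by move=> /size0nil E; have [_ _] := root_pathP o v; rewrite E. Qed.

Lemma level_adj_root o v : adj o v -> level o v = 1%N.
Proof.
move=> ov; rewrite /level (@root_path_eq o v [:: v]) //= ?ov //.
rewrite inE andbT; apply: contraTneq ov => ->; by rewrite adj_irr.
Qed.

(** The neighbor is the penultimate vertex of the simple path from [o] to [v]: dropping [v] leaves a
    simple path one edge shorter. *)
Lemma lower_neighbor o v :
  v <> o -> exists2 u, adj v u & (level o u < level o v)%N.
Proof.
move=> vo; have [] := root_pathP o v; rewrite /level.
case: (lastP (root_path o v)) => [|q z]; first by move=> _ _ /= /esym.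
rewrite rcons_path last_rcons -rcons_cons rcons_uniq.
move=> /andP[pq qz] /andP[_ uq] zE; subst z.
by exists (last o q); rewrite 1?adj_sym // (root_path_eq pq uq) // size_rcons.
Qed.

Lemma parentP o v : v <> o ->
  adj v (parent o v) /\ forall w, adj v w -> (level o (parent o v) <= level o w)%N.
Proof.
move=> vo; rewrite /parent; case: xgetP => [u _ //|nP]; exfalso.
have [u0 vu0 _] := lower_neighbor vo.
pose P n := `[< exists2 u, adj v u & level o u = n >].
have exP : exists n, P n by exists (level o u0); apply/asboolP; exists u0.
case: (ex_minnP exP) => n /asboolP[u vu un] nmin; apply: (nP u); split=> //.
by move=> w vw; rewrite un; apply: nmin; apply/asboolP; exists w.
Qed.

Lemma level_parent o v : v <> o -> (level o (parent o v) < level o v)%N.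
Proof.
move=> vo; have [_ pmin] := parentP vo; have [u vu uv] := lower_neighbor vo.
exact: leq_ltn_trans (pmin u vu) uv.
Qed.

Lemma parent_root_level o v : v <> o -> parent o v = o -> level o v = 1%N.
Proof.
by move=> vo po; have [] := parentP vo; rewrite po adj_sym => /level_adj_root.
Qed.

(** Such a vertex makes the set of weighted gradients nonempty and attains the supremum for
    [root_bump]. The first step of a path from [o] to any other vertex has level 1, so its parent
    has level 0. *)
Lemma exists_child_of_root o : exists2 v, v <> o & parent o v = o.
Proof.
have [w wo] : exists w, w <> o.
  apply: contrapT => nw; apply: (@tree_infinite T).
  apply: (@sub_finite_set _ _ [set o]) => // w _ /=.
  by apply: contrapT => wo; apply: nw; exists w.
have [[|v p] [] /=] := @tree_connected T o w; first by move=> _ /esym.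
move=> /andP[ov _] _; exists v.
  by move=> vo; rewrite vo adj_irr in ov.
have vo : v <> o by move=> vo; rewrite vo adj_irr in ov.
apply: level_eq0; apply/eqP.
by rewrite -leqn0 -ltnS -[X in (_ < X)%N](level_adj_root ov) level_parent.
Qed.

End Paths.

(** * Norms of the test functions, and functions with zero gradient *)

Section Lipschitz.
Set Implicit Arguments.
Unset Strict Implicit.
Variables (T : tree) (o : T) (R : realType).
Implicit Types (f : T -> R[i]) (c : R[i]).

Lemma normc_ge0 c : 0 <= Normc.normc c.
Proof. by case: c => a b; exact: sqrtr_ge0. Qed.

Lemma sup_of_max (A : set R) m : A m -> ubound A m -> sup A = m.
Proof.
move=> Am Um; apply/eqP; rewrite eq_le; apply/andP; split.
  by apply: ge_sup => //; exists m.
by apply: ub_le_sup => //; exists m.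
Qed.

Lemma grad_cst c v : grad o (fun=> c) v = 0.
Proof. by rewrite /grad subrr Normc.normc0. Qed.

Lemma Lw0_cst c : Lw0 o (fun=> c).
Proof.
split; first by exists 0 => _ [v _ <-]; rewrite grad_cst mulr0.
have -> : (fun v : T => (level o v)%:R * grad o (fun=> c) v) = fun=> 0.
  by apply/funext => v; rewrite grad_cst mulr0.
exact: cvg_cst.
Qed.

Lemma normw_cst c : normw o (fun=> c) = Normc.normc c.
Proof.
have [v vo _] := exists_child_of_root o.
rewrite /normw (@sup_of_max _ 0) ?addr0 //.
  by exists v => //; rewrite grad_cst mulr0.
by move=> _ [w _ <-]; rewrite grad_cst mulr0.
Qed.

(** The value [c] is left free because multiplying the indicator of [o] by [psi] gives
    [root_bump (psi o)]. *)
Definition root_bump c : T -> R[i] := fun v => if v == o then c else 0.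

(** Off [o], only the children of [o] see a jump, and their weight is 1. *)
Lemma weighted_grad_root_bump c v : v <> o ->
  (level o v)%:R * grad o (root_bump c) v =
  if parent o v == o then Normc.normc c else 0.
Proof.
move=> vo; rewrite /grad /root_bump; move/eqP/negPf: (vo) => ->.
case: eqP => [po|_]; last by rewrite subrr Normc.normc0 mulr0.
by rewrite parent_root_level // mul1r sub0r normcN.
Qed.

Lemma ubound_root_bump c :
  ubound (weighted_grads o (root_bump c)) (Normc.normc c).
Proof.
move=> _ [v vo <-]; rewrite weighted_grad_root_bump //.
by case: ifP => // _; exact: normc_ge0.
Qed.

Lemma Lw0_root_bump c : Lw0 o (root_bump c).
Proof.
split; first by exists (Normc.normc c); exact: ubound_root_bump.
(* Children of [o] have level 1, so the weighted gradient vanishes from level 2 on. *)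
apply: cvg_near_cst; exists 2%N => // v /= v2.
have vo : v <> o by move=> vo; rewrite vo level_root in v2.
rewrite weighted_grad_root_bump //; case: eqP => // po.
by rewrite parent_root_level in v2.
Qed.

(** One copy of the modulus is the value at [o], the other the supremum, attained at a child of
    [o]. *)
Lemma normw_root_bump c : normw o (root_bump c) = Normc.normc c *+ 2.
Proof.
have [v vo po] := exists_child_of_root o.
rewrite /normw (@sup_of_max _ (Normc.normc c)); first 1 last.
- by exists v => //; rewrite weighted_grad_root_bump // po eqxx.
- exact: ubound_root_bump.
by rewrite /root_bump eqxx mulr2n.
Qed.

(** Induction on the level, descending from [v] to its parent. *)
Lemma grad0_constant f : (forall v, v <> o -> grad o f v = 0) ->
  forall v, f v = f o.
Proof.
move=> f0 v; have [n] := ubnP (level o v); elim: n v => // n IH v.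
rewrite ltnS => vn; have [->//|/eqP vo] := eqVneq v o.
have /eqP := f0 v vo; rewrite /grad => /eqP/Normc.eq0_normc/eqP.
rewrite subr_eq0 => /eqP ->; apply: IH.
exact: leq_trans (level_parent vo) vn.
Qed.

(** Membership in [Lw] matters: [sup] of an unbounded set is 0 by default. Off [o] the level is
    positive and can be divided out. *)
Lemma sup_weighted_grads_eq0 f : Lw o f -> sup (weighted_grads o f) = 0 ->
  forall v, v <> o -> grad o f v = 0.
Proof.
move=> ub s0 v vo; apply/eqP; rewrite eq_le normc_ge0 andbT.
have lv : 0 < (level o v)%:R :> R.
  by rewrite ltr0n (leq_ltn_trans _ (level_parent vo)).
rewrite -(pmulr_rle0 _ lv) -s0; apply: ub_le_sup => //.
by exists v.
Qed.

Lemma grad_mult_cst c f : Normc.normc c = 1 ->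
  grad o (mult_op (fun=> c) f) = grad o f.
Proof.
move=> c1; apply/funext => v.
by rewrite /grad /mult_op -mulrBr Normc.normcM c1 mul1r.
Qed.

End Lipschitz.

Theorem theorem9p1 (R : realType) (T : tree) (o : T) (X : set (T -> R[i]))
    (hX : X = @Lw T o R \/ X = @Lw0 T o R) (psi : T -> R[i]) :
  isometric_mult_op o X psi <->
  exists c : R[i], Normc.normc c = 1 /\ forall v : T, psi v = c.
Proof.
split=> [[psiX iso]|[c [c1 psic]]].
  (* Both cases of [X] are treated at once, using only that [X] lies between [Lw0] and [Lw]. *)
  have X0 f : Lw0 o f -> X f by case: hX => -> // -[].
  have XL f : X f -> Lw o f by case: hX => -> // -[].
  have psi1 : mult_op psi (fun=> 1) = psi by apply/funext => v; exact: mulr1.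
  have psib : mult_op psi (root_bump o 1) = root_bump o (psi o).
    apply/funext => v; rewrite /mult_op /root_bump.
    by case: eqP => [->|_]; rewrite ?mulr1 ?mulr0.
  have psio : Normc.normc (psi o) = 1.
    have := iso _ (X0 _ (Lw0_root_bump o 1)).
    rewrite psib !normw_root_bump Normc.normc1 => /eqP.
    by rewrite eqr_pMn2r // => /eqP.
  exists (psi o); split=> //; apply: grad0_constant.
  apply: sup_weighted_grads_eq0.
    (* [psi] is the image of the constant 1, hence in [X]. *)
    by rewrite -psi1; apply: XL; apply/psiX/X0/Lw0_cst.
  have := iso _ (X0 _ (Lw0_cst o 1)).
  rewrite psi1 normw_cst Normc.normc1 /normw psio => /eqP.
  by rewrite -subr_eq0 addrC addKr => /eqP.
have -> : psi = fun=> c by apply/funext.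
(* A factor of modulus one changes no gradient, which settles both membership in [X] and the
   norm. *)
have wg f : weighted_grads o (mult_op (fun=> c) f) = weighted_grads o f.
  by rewrite /weighted_grads grad_mult_cst.
split=> f; last by rewrite /normw wg /mult_op Normc.normcM c1 mul1r.
by case: hX => ->; rewrite /Lw0 /Lw /= wg ?grad_mult_cst.
Qed.
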